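(* Let $d=1$ and $S=[-1/2,+1/2]$. Then for every $\hat c\in\mathbb{R}$ and every $c\in\{-1,+1\}$, $\ell_{\mathrm{SPO+}}(\hat c,c)=\max\{0,1-2c\hat c\}$, i.e., the SPO+ loss function is equivalent to the hinge loss function associated with binary classification (evaluated at $2\hat c$).
   Context: For $c\in\mathbb{R}$: $z^*(c) := \min_{w\in S} cw$, and $w^*(\cdot):\mathbb{R}\to S$ is a fixed mapping with $w^*(c)\in\arg\min_{w\in S} cw$ for all $c$. The SPO+ loss is $\ell_{\mathrm{SPO+}}(\hat c,c) := \max_{w\in S}\{cw-2\hat cw\}+2\hat c\,w^*(c)-z^*(c)$. The hinge loss of a prediction $\hat c\in\mathbb{R}$ for label $c\in\{-1,+1\}$ is $\max\{0,1-c\hat c\}$. *)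

(* Defs.v *)
From HB Require Import structures.
From mathcomp Require Import all_boot all_order all_algebra.
From mathcomp Require Import all_classical all_reals.

Set Implicit Arguments.
Unset Strict Implicit.
Unset Printing Implicit Defensive.

Import Order.TTheory GRing.Theory Num.Theory.
Local Open Scope classical_set_scope.
Local Open Scope ring_scope.

Section SPOplus.
Context {R : realType}.
Implicit Types (A S : set R) (f w : R -> R) (c m : R).

(* [minimum A] and [maximum A] are attained extrema, unlike [inf] and [sup];
   they default to 0 when there is none. *)
Definition minimum A : R := xget 0 (A `&` lbound A).
Definition maximum A : R := xget 0 (A `&` ubound A).

Lemma minimumE A m : A m -> lbound A m -> minimum A = m.
Proof.
move=> Am lAm; apply: xget_unique => // y [Ay lAy].
by apply/le_anti; rewrite lAy// lAm.
Qed.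

Lemma maximumE A m : A m -> ubound A m -> maximum A = m.
Proof.
move=> Am uAm; apply: xget_unique => // y [Ay uAy].
by apply/le_anti; rewrite uAm// uAy.
Qed.

Definition argmin S f : set R :=
  [set u | S u /\ forall v, S v -> f u <= f v].

Definition zstar S c : R := minimum [set c * u | u in S].

Definition is_oracle S w : Prop :=
  forall c, argmin S (fun u => c * u) (w c).

(* The first argument after [S] and the oracle [w] is the prediction, the
   second the label. *)
Definition spo_plus_loss S w (chat c : R) : R :=
  maximum [set c * u - 2 * chat * u | u in S] + 2 * chat * w c - zstar S c.

Definition hinge_loss (chat c : R) : R := Num.max 0 (1 - c * chat).

End SPOplus.

(* Main.v *)
(* On [-1/2, 1/2] the map u |-> a u has maximum |a|/2 and minimum -|a|/2, and
   c w*(c) = z*(c) forces w*(c) = -c/2 for c = 1 or -1. With t := 1 - 2 c chat,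
   so that |c - 2 chat| = |t|, the loss is (|t| + t)/2 = max(0, t). *)
Require Import Defs.
From HB Require Import structures.
From mathcomp Require Import all_boot all_order all_algebra.
From mathcomp Require Import all_classical all_reals.
From mathcomp Require Import lra.

Set Implicit Arguments.
Unset Strict Implicit.
Unset Printing Implicit Defensive.

Import Order.TTheory GRing.Theory Num.Theory.
Local Open Scope classical_set_scope.
Local Open Scope ring_scope.

Lemma maximum_linear_itv (R : realType) (r a : R) : 0 <= r ->
  maximum [set a * u | u in [set u : R | - r <= u <= r]] = `|a| * r.
Proof.
move=> r0; apply: maximumE => [|_ [u /= uI <-]].
  (* The sign of [a] selects the maximizing endpoint without a case split; for [a = 0] the witness
     is 0, still in the interval since [r] is nonnegative. *)
  exists (Num.sg a * r); last by rewrite mulrA (mulrC a) -normrEsg.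
  rewrite /= -ler_norml normrM (ger0_norm r0) normr_sg.
  by rewrite ler_piMl// lern1 leq_b1.
by rewrite (le_trans (ler_norm _))// normrM ler_wpM2l// ler_norml.
Qed.

Lemma minimum_linear_itv (R : realType) (r a : R) : 0 <= r ->
  minimum [set a * u | u in [set u : R | - r <= u <= r]] = - (`|a| * r).
Proof.
move=> r0; apply: minimumE => [|_ [u /= uI <-]].
  exists (- (Num.sg a * r)); last by rewrite mulrN mulrA (mulrC a) -normrEsg.
  rewrite /= -ler_norml normrN normrM (ger0_norm r0) normr_sg.
  by rewrite ler_piMl// lern1 leq_b1.
rewrite lerNl (le_trans (ler_norm _))// normrN normrM.
by rewrite ler_wpM2l// ler_norml.
Qed.

(** The point [w c] itself attains the minimum, so the default value of [minimum] never enters,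
    whatever [S] is. *)
Lemma oracle_zstar (R : realType) (S : set R) (w : R -> R) (c : R) :
  is_oracle S w -> c * w c = zstar S c.
Proof.
move=> /(_ c)[Sw le_w]; apply/esym/minimumE; first by exists (w c).
by move=> _ [u Su <-]; exact: le_w.
Qed.

Theorem proposition4 (R : realType) (S : set R)
    (hS : S = [set u : R | - (1 / 2) <= u <= 1 / 2])
    (wstar : R -> R) (hwstar : is_oracle S wstar)
    (chat c : R) (hc : c = -1 \/ c = 1) :
  spo_plus_loss S wstar chat c = Num.max 0 (1 - 2 * c * chat) /\
  spo_plus_loss S wstar chat c = hinge_loss (2 * chat) c.
Proof.
have half0 : 0 <= 1 / 2 :> R by lra.
have zE : zstar S c = - (`|c| * (1 / 2)).
  by rewrite /zstar hS minimum_linear_itv.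
have := oracle_zstar c hwstar; rewrite /hinge_loss /spo_plus_loss zE => wE.
(* A single slope [c - 2 * chat] brings the maximum into the form of [maximum_linear_itv]. *)
have -> : (fun u => c * u - 2 * chat * u) = (fun u => (c - 2 * chat) * u).
  by apply/funext => u; rewrite mulrBl.
have -> : c * (2 * chat) = 2 * c * chat by rewrite mulrCA mulrA.
rewrite hS maximum_linear_itv//.
(* Both conjuncts now have the same two sides, so one equation settles them. *)
suff -> : `|c - 2 * chat| * (1 / 2) + 2 * chat * wstar c - - (`|c| * (1 / 2)) =
    Num.max 0 (1 - 2 * c * chat) by [].
case: hc wE => ->; rewrite ?normrN normr1 => wE.
- have -> : wstar (-1) = 1 / 2 by lra.
  (* Here [c - 2 * chat] is the negative of [1 - 2 * c * chat], so the norm opens with the sign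
     opposite to the one [leP] decides; for [c = 1] the two coincide. *)
  by case: leP => h; [rewrite ler0_norm|rewrite ger0_norm]; lra.
- have -> : wstar 1 = - (1 / 2) by lra.
  by case: leP => h; [rewrite ger0_norm|rewrite ler0_norm]; lra.
Qed.
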